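(* Let $(M,g)$ be an $n$-dimensional semi-Riemann manifold, let $X$ be a $C^\infty$ vector field on $M$, let $f=\frac12 g(X,X)$, and let $F=\nabla X-g^{-1}\otimes g(\nabla X)$ be the associated $(1,1)$-tensor field. Consider the dynamical systems $$\text{(A)}\quad \frac{\nabla}{dt}\frac{dx}{dt}=\operatorname{grad} f,\qquad\qquad \text{(B)}\quad \frac{\nabla}{dt}\frac{dx}{dt}=\operatorname{grad} f+F\left(\frac{dx}{dt}\right).$$ 1) The trajectories of (A) are the extremals of the Lagrangian $$L=\frac12 g\left(\frac{dx}{dt},\frac{dx}{dt}\right)+f(x).$$ 2) The trajectories of (B) are the extremals of the Lagrangian $$L=\frac12 g\left(\frac{dx}{dt}-X,\frac{dx}{dt}-X\right)=\frac12 g\left(\frac{dx}{dt},\frac{dx}{dt}\right)-g\left(X,\frac{dx}{dt}\right)+f(x).$$ 3) The dynamical systems (A) and (B) are conservative, the Hamiltonian being the same in both cases, namely $$H=\frac12 g\left(\frac{dx}{dt},\frac{dx}{dt}\right)-f(x).$$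
   Context: A semi-Riemann metric $g$ on $M$ is a $C^\infty$ symmetric $(0,2)$-tensor field that is a nondegenerate inner product on each tangent space, of some signature $(r,s)$. $\nabla$ is the Levi-Civita connection of $g$, $\frac{\nabla}{dt}$ is covariant differentiation along a curve, and $\operatorname{grad}$ is the gradient with respect to $g$. In local coordinates (summation convention), $F$ has components $$F_j{}^i=\nabla_jX^i-g^{ih}g_{kj}\nabla_hX^k,\qquad F(v)^i=F_j{}^iv^j .$$ Trajectories are solution curves $x(t)$. Extremals of a Lagrangian $L(x,\dot x)$ are the solutions of its Euler--Lagrange equations. The tangent bundle $TM$ is identified with the cotangent bundle $T^*M$ by means of $g$, and the Hamiltonian of $L$ is expressed in terms of $(x,\dot x)$ as $H=\dot x^i\,\partial L/\partial\dot x^i-L$. Conservative means that the Hamiltonian is constant along every trajectory. *)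

(* Defs.v *)
From HB Require Import structures.
From mathcomp Require Import all_boot all_order all_algebra.
From mathcomp Require Import all_classical all_reals all_analysis.
From mathcomp Require Import ring.

Set Implicit Arguments.
Unset Strict Implicit.
Unset Printing Implicit Defensive.

Import Order.TTheory GRing.Theory Num.Theory.
Import numFieldNormedType.Exports.

Local Open Scope classical_set_scope.
Local Open Scope ring_scope.

(* Class C^k on an open subset U of a finite-dimensional space: f is C^(k+1)
   iff f is differentiable on U and its differential is C^k, that is, all its
   directional derivatives are C^k. *)
Fixpoint Ck (R : realType) (V W : normedModType R) (k : nat) (U : set V)
    (f : V -> W) : Prop :=
  match k with
  | 0 => forall u, U u -> {for u, continuous f}
  | k'.+1 => (forall u, U u -> differentiable f u) /\
             forall v, Ck k' U (fun u => 'D_v f u)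
  end.

Definition smooth (R : realType) (V W : normedModType R) (U : set V)
  (f : V -> W) : Prop := forall k, Ck k U f.

Definition partial (R : realType) (n : nat) (k : 'I_n) (h : 'rV[R]_n -> R)
  (u : 'rV[R]_n) : R := 'D_(delta_mx 0 k) h u.

(* [coord i] is meaningful on [source i] only, and [inv i] on its image.
   [chart_at] selects a chart around each point; it is used to represent a
   tangent vector at p by its components in the chart [chart_at p]. *)
Record manifold (R : realType) (n : nat) := Manifold {
  carrier :> topologicalType ;
  carrier_hausdorff : hausdorff_space carrier ;
  carrier_second_countable : @second_countable carrier ;
  atlas : Type ;
  source : atlas -> set carrier ;
  coord : atlas -> carrier -> 'rV[R]_n ;
  inv : atlas -> 'rV[R]_n -> carrier ;
  open_source : forall i, open (source i) ;
  open_target : forall i, open (coord i @` source i) ;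
  coordK : forall i p, source i p -> inv i (coord i p) = p ;
  coord_continuous : forall i p, source i p -> {for p, continuous (coord i)} ;
  inv_continuous : forall i u, (coord i @` source i) u ->
    {for u, continuous (inv i)} ;
  transition_smooth : forall i j,
    smooth (coord i @` (source i `&` source j)) (coord j \o inv i) ;
  chart_at : carrier -> atlas ;
  source_chart_at : forall p, source (chart_at p) p }.

Section Manifold.
Context {R : realType} {n : nat} {M : manifold R n}.
Implicit Types (i j : atlas M) (p : M) (u v w : 'rV[R]_n).

Definition target i : set 'rV[R]_n := coord i @` source i.

(* The matrix, acting on row vectors, that turns the components of a tangent
   vector at p in the chart i into its components in the chart j. *)
Definition tangent_change i j p : 'M[R]_n :=
  'J (coord j \o inv i) (coord i p).

(* The components in the chart i, at the point of coordinates u, of a field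
   [Y] of tangent vectors, resp. a field [G] of bilinear forms on the tangent
   spaces. In the second case the entry (a, b) is the value on the a-th and
   b-th coordinate vectors of the chart i. *)
Definition vcomp i (Y : M -> 'rV[R]_n) u : 'rV[R]_n :=
  Y (inv i u) *m tangent_change (chart_at (inv i u)) i (inv i u).

Definition bcomp i (G : M -> 'M[R]_n) u : 'M[R]_n :=
  let P := tangent_change i (chart_at (inv i u)) (inv i u) in
  P *m G (inv i u) *m P^T.

End Manifold.

Record vector_field (R : realType) (n : nat) (M : manifold R n) :=
  VectorField {
    vf :> M -> 'rV[R]_n ;
    vf_smooth : forall i, smooth (target i) (vcomp i vf) }.

Definition has_signature (R : realType) (n : nat) (G : 'M[R]_n) (r s : nat) :
    Prop :=
  (r + s)%N = n /\
  exists2 P : 'M[R]_n, P \in unitmx &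
    P *m G *m P^T = diag_mx (\row_(k < n) if (k < r)%N then 1 else -1).

Record semi_riemann_metric (R : realType) (n : nat) (M : manifold R n) :=
  SemiRiemannMetric {
    gram :> M -> 'M[R]_n ;
    gram_smooth : forall i a b,
      smooth (target i) (fun u => bcomp i gram u a b) ;
    gram_sym : forall p, (gram p)^T = gram p ;
    gram_nondegenerate : forall p, gram p \in unitmx ;
    index_pos : nat ;
    index_neg : nat ;
    gram_signature : forall p, has_signature (gram p) index_pos index_neg }.

Section Geometry.
Context {R : realType} {n : nat} {M : manifold R n}.
Variable g : semi_riemann_metric M.
Implicit Types (i : atlas M) (p : M) (u v w : 'rV[R]_n) (a b c h : 'I_n).

Definition inner p v w : R := (v *m g p *m w^T) 0 0.

Definition gdown i u : 'M[R]_n := bcomp i g u.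
Definition gup i u : 'M[R]_n := invmx (gdown i u).

(* [christoffel i u c a b] is Gamma^c_(ab); see [levi_civitaP] below. *)
Definition christoffel i u c a b : R :=
  2^-1 * \sum_h gup i u c h *
    (partial a (fun u' => gdown i u' b h) u
     + partial b (fun u' => gdown i u' a h) u
     - partial h (fun u' => gdown i u' a b) u).

(* The covariant derivative, along a curve given in the chart i by [x], of a
   field of tangent vectors along that curve with components [V]. *)
Definition nabla_dt i (x V : R -> 'rV[R]_n) (t : R) : 'rV[R]_n :=
  \row_c (derive1 V t 0 c
    + \sum_a \sum_b christoffel i (x t) c a b * derive1 x t 0 a * V t 0 b).

Definition grad i (f : M -> R) u : 'rV[R]_n :=
  \row_a \sum_h gup i u a h * partial h (f \o inv i) u.

(* The entry (b, a) is nabla_b X^a. *)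
Definition nabla i (X : M -> 'rV[R]_n) u : 'M[R]_n :=
  \matrix_(b, a) (partial b (fun u' => vcomp i X u' 0 a) u
    + \sum_c christoffel i u a b c * vcomp i X u 0 c).

(* The entry (b, a) is F_b^a. *)
Definition Ftensor i (X : M -> 'rV[R]_n) u : 'M[R]_n :=
  \matrix_(b, a) (nabla i X u b a
    - \sum_h \sum_c gup i u a h * gdown i u c b * nabla i X u h c).

(* The Levi-Civita connection is the unique connection which is torsion-free
   and for which the metric is parallel. *)
Lemma levi_civitaP i u (Gamma : 'I_n -> 'I_n -> 'I_n -> R) :
  gdown i u \in unitmx ->
  ((forall c a b, Gamma c a b = Gamma c b a) /\
   (forall h a b, partial h (fun u' => gdown i u' a b) u
      = \sum_c (Gamma c h a * gdown i u c b + Gamma c h b * gdown i u a c)))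
  <-> (forall c a b, Gamma c a b = christoffel i u c a b).
Proof.
move=> gU; set G := gdown i u.
have symG u' a b : gdown i u' a b = gdown i u' b a.
  have gT : (gdown i u')^T = gdown i u'.
    by rewrite /gdown /bcomp !trmx_mul trmxK gram_sym mulmxA.
  by rewrite -[in LHS]gT mxE.
pose d h a b := partial h (fun u' => gdown i u' a b) u.
have symd h a b : d h a b = d h b a.
  by rewrite /d; under eq_fun => u' do rewrite symG.
have low (Ga : 'I_n -> 'I_n -> 'I_n -> R) :
  (forall c a b, Ga c a b = christoffel i u c a b) <->
  (forall h a b, \sum_c Ga c a b * G c h = 2^-1 * (d a b h + d b a h - d h a b)).
  pose D a b : 'cV[R]_n := \col_h (2^-1 * (d a b h + d b a h - d h a b)).
  pose C a b : 'cV[R]_n := \col_c Ga c a b.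
  have chE c a b : christoffel i u c a b = (invmx G *m D a b) c 0.
    rewrite [RHS]mxE /christoffel mulr_sumr; apply: eq_bigr => h _.
    by rewrite [D a b h 0]mxE mulrCA.
  have lowE a b h : \sum_c Ga c a b * G c h = (G *m C a b) h 0.
    rewrite [RHS]mxE; apply: eq_bigr => c _.
    by rewrite [C a b c 0]mxE mulrC /G symG.
  split=> H.
    move=> h a b; rewrite lowE.
    suff -> : C a b = invmx G *m D a b by rewrite mulKVmx // mxE.
    by apply/colP => c; rewrite mxE H chE.
  move=> c a b; rewrite chE.
  suff <- : G *m C a b = D a b by rewrite mulKmx // mxE.
  by apply/colP => h; rewrite -lowE H mxE.
have two : (2 : R) != 0 by rewrite pnatr_eq0.
split=> [[sym par]|H].
  apply/low => h a b.
  pose S x y z := \sum_c Gamma c x y * G c z.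
  have dS x y z : d x y z = S x y z + S x z y.
    rewrite /d par big_split /=; congr (_ + _).
    by apply: eq_bigr => c _; rewrite [gdown i u y c]symG.
  have Ssym x y z : S x y z = S y x z.
    by apply: eq_bigr => c _; rewrite sym.
  rewrite -/(S a b h) !dS (Ssym b a) (Ssym h b) (Ssym h a); by field.
have H' := (low Gamma).1 H; split.
  move=> c a b; rewrite !H /christoffel; congr (_ * _).
  apply: eq_bigr => h _; congr (_ * _).
  rewrite [partial a _ _ + _]addrC; congr (_ - _).
  exact: (symd h a b).
move=> h a b; rewrite big_split /= H'.
under [X in _ + X]eq_bigr => c _ do rewrite symG.
rewrite H' -/(d h a b) (symd h b a).
by field.
Qed.

Definition C2_curve (J : set R) (x : R -> M) : Prop :=
  (forall t, J t -> {for t, continuous x}) /\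
  forall i, Ck 2 (J `&` x @^-1` source i) (coord i \o x).

(* A second-order system nabla/dt (dx/dt) = force(x, dx/dt), with [force]
   given by its components in each chart. *)
Definition trajectory (force : atlas M -> 'rV[R]_n -> 'rV[R]_n -> 'rV[R]_n)
    (J : set R) (x : R -> M) : Prop :=
  [/\ open J, is_interval J, C2_curve J x &
    forall i t, J t -> source i (x t) ->
      let xi : R -> 'rV[R]_n := coord i \o x in
      nabla_dt i xi (derive1 xi) t = force i (xi t) (derive1 xi t)].

Definition systemA (f : M -> R) i u v : 'rV[R]_n :=
  grad i f u.
Definition systemB (X : M -> 'rV[R]_n) (f : M -> R) i u v : 'rV[R]_n :=
  grad i f u + v *m Ftensor i X u.

End Geometry.

Section Lagrangian.
Context {R : realType} {n : nat} {M : manifold R n}.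
Implicit Types (L H : M -> 'rV[R]_n -> R).

Definition lcomp (i : atlas M) L (u v : 'rV[R]_n) : R :=
  L (inv i u) (v *m tangent_change i (chart_at (inv i u)) (inv i u)).

Definition extremal L (J : set R) (x : R -> M) : Prop :=
  [/\ open J, is_interval J, C2_curve J x &
    forall i t, J t -> source i (x t) ->
      let xi : R -> 'rV[R]_n := coord i \o x in
      forall k : 'I_n,
        is_derive t 1 (fun s => partial k (lcomp i L (xi s)) (derive1 xi s))
          (partial k (fun u => lcomp i L u (derive1 xi t)) (xi t))].

Definition hamiltonian L (p : M) (v : 'rV[R]_n) : R :=
  \sum_k v 0 k * partial k (L p) v - L p v.

(* The tangent vector dx/dt at the point x t. *)
Definition velocity (x : R -> M) (t : R) : 'rV[R]_n :=
  derive1 (coord (chart_at (x t)) \o x) t.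

Definition conservative (traj : set R -> (R -> M) -> Prop) H : Prop :=
  forall J x, traj J x -> forall t1 t2, J t1 -> J t2 ->
    H (x t1) (velocity x t1) = H (x t2) (velocity x t2).

End Lagrangian.

(* Main.v *)
Require Import Defs.
From mathcomp Require Import all_boot all_order all_algebra.
From mathcomp Require Import all_classical all_reals all_analysis.
From mathcomp Require Import ring.

Set Implicit Arguments.
Unset Strict Implicit.
Unset Printing Implicit Defensive.

Import Order.TTheory GRing.Theory Num.Theory.
Import numFieldNormedType.Exports.
(* [coord] would otherwise be the one of [vector]. *)
Import Defs.

Local Open Scope classical_set_scope.
Local Open Scope ring_scope.

(** Both Lagrangians have the form L = g(v, v)/2 - w(v) + f for a field w of
    covectors: w = 0 for (A) and w = g(X, -) for (B). Lowering an index with g,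
    the Euler-Lagrange equations of L in a chart become

      g(nabla v/dt, -) = df + dw(v, -),

    because g_ck Gamma^c_ab v^a v^b = (d_a g_bk - d_k g_ab / 2) v^a v^b. As the
    metric is parallel and the connection torsion-free, the lowering of F is
    exactly dw for w = g(X, -). Since dw(v, v) = 0, the term w does not
    contribute to the derivative of g(v, v)/2 - f along a solution, which
    therefore vanishes for (A) and (B) alike. *)

(** * Calculus on normed spaces: locality, products, chain rule, Jacobians *)

Section Calculus.
Context {R : realType}.

(** The difference [g - f] vanishes near [x], so its increment is little-o of the identity and its
    differential is zero; [g] is [f] plus this difference. *)
Lemma near_eq_differentiable {V W : normedModType R} (f g : V -> W) (x : V) :
  (\near x, f x = g x) -> differentiable f x -> differentiable g x.
Proof.
move=> fg df; pose h := g - f.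
have h0 : \forall y \near (0 : V), h (y + x) = 0.
  rewrite (near_shift x)/=.
  near=> y; rewrite /= sub0r subrK /h !fctE.
  by rewrite (_ : g y = f y) ?subrr//; symmetry; near: y.
have hx : h x = 0 by have := nbhs_singleton h0; rewrite add0r.
have hE : h \o shift x = cst (h x) + \0 +o_ 0 id.
  apply/eqaddoP => e e0; near=> y.
  rewrite [leLHS](_ : _ = `|h (y + x) - (h x + 0)|)// hx addr0 subr0.
  by rewrite (_ : h (y + x) = 0) ?normr0 ?mulr_ge0 ?normr_ge0 ?(ltW e0)//; near: y.
have dh0 : 'd h x = \0 :> (V -> W).
  by apply: diff_unique hE => y; exact: cst_continuous.
suff -> : g = f + h.
  apply: differentiableD => //; apply/diff_locallyP; rewrite dh0; split => //.
  by move=> y; exact: cst_continuous.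
by apply/funext => y; rewrite /h !fctE addrCA subrr addr0.
Unshelve. all: by end_near. Qed.

Lemma is_derive_big {V : normedModType R} (I : finType) (h : I -> V -> R)
    (dh : I -> R) (x v : V) :
  (forall i, is_derive x v (h i) (dh i)) ->
  is_derive x v (fun y => \sum_i h i y) (\sum_i dh i).
Proof.
move=> hd; rewrite (_ : (fun y => _) = \sum_i h i); last first.
  by apply/funext => y; rewrite fct_sumE.
by elim/big_ind2 : _ => // [|] *; [exact: is_derive_cst|exact: is_deriveD].
Qed.

Lemma is_derive_mul {V : normedModType R} (f g : V -> R) (x v : V) df dg :
  is_derive x v f df -> is_derive x v g dg ->
  is_derive x v (fun y => f y * g y) (df * g x + f x * dg).
Proof.
by move=> fd gd; apply: is_derive_eq; rewrite addrC /GRing.scale/= mulrC.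
Qed.

Lemma is_derive_entry {V : normedModType R} {m n : nat} (A : V -> 'M[R]_(m, n))
    x v i j :
  derivable A x v -> is_derive x v (fun y => A y i j) ('D_v A x i j).
Proof.
move=> dA; rewrite derive_mx// mxE; apply: derivableP.
exact: (derivable_mxP A x v).1.
Qed.

Lemma is_derive_along {n : nat} (h : 'rV[R]_n -> R) (x : R -> 'rV[R]_n) t :
  differentiable h (x t) -> differentiable x t ->
  is_derive t 1 (h \o x) (\sum_b derive1 x t 0 b * partial b h (x t)).
Proof.
move=> dh dx; have dhx : differentiable (h \o x) t.
  exact: differentiable_comp.
apply: DeriveDef; first exact: diff_derivable.
have dx1 : 'd x t 1 = derive1 x t by rewrite derive1E deriveE.
rewrite deriveE// diff_comp//= dx1.
rewrite [in LHS](row_sum_delta (derive1 x t)) linear_sum; apply: eq_bigr => b _.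
by rewrite linearZ /partial deriveE.
Qed.

Lemma derive_comp_jacobian {V : normedModType R} {m k : nat} (f : V -> 'rV[R]_m)
    (h : 'rV[R]_m -> 'rV[R]_k) u v :
  differentiable f u -> differentiable h (f u) ->
  'D_v (h \o f) u = 'D_v f u *m 'J h (f u).
Proof.
move=> df dh; rewrite deriveE; last exact: differentiable_comp.
by rewrite diff_comp//= deriveE// /jacobian mul_rV_lin1.
Qed.

Lemma jacobian_comp {m n k : nat} (f : 'rV[R]_m -> 'rV[R]_n)
    (h : 'rV[R]_n -> 'rV[R]_k) u :
  differentiable f u -> differentiable h (f u) ->
  'J (h \o f) u = 'J f u *m 'J h (f u).
Proof.
move=> df dh; apply/row_matrixP => b; rewrite !rowE mulmxA.
by rewrite /jacobian !mul_rV_lin1 diff_comp.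
Qed.

Lemma near_id_jacobian {n : nat} (f : 'rV[R]_n -> 'rV[R]_n) u :
  (\near u, f u = u) -> differentiable f u -> 'J f u = 1%:M.
Proof.
move=> fE df; apply/row_matrixP => b; rewrite !rowE mulmx1 -deriveEjacobian//.
by rewrite (near_eq_derive _ fE) derive_id.
Qed.

End Calculus.

(** * Chart overlaps and the change of tangent components *)

Section Charts.
Context {R : realType} {n : nat} {M : manifold R n}.
Implicit Types (i j : atlas M) (p : M) (u v w : 'rV[R]_n).

Lemma targetP i u : target i u -> source i (inv i u) /\ coord i (inv i u) = u.
Proof. by move=> [p ip <-]; rewrite coordK. Qed.

Lemma near_overlap i j p : source i p -> source j p ->
  \forall u \near coord i p, target i u /\ source j (inv i u).
Proof.
move=> ip jp; have ti : target i (coord i p) by exists p.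
near=> u; split; near: u.
  by apply: open_nbhs_nbhs; split=> //; exact: open_target.
have := inv_continuous ti; apply; rewrite coordK//.
by apply: open_nbhs_nbhs; split=> //; exact: open_source.
Unshelve. all: by end_near. Qed.

Lemma near_target i u : target i u -> \forall u' \near u, target i u'.
Proof. by move=> iu; apply: open_nbhs_nbhs; split=> //; exact: open_target. Qed.

Lemma transition_differentiable i j p : source i p -> source j p ->
  differentiable (coord j \o inv i) (coord i p).
Proof. by move=> ip jp; apply: (transition_smooth i j 1).1; exists p. Qed.

(** Chain rule for the composite of the two opposite transition maps. It is the identity only on the
    overlap, whose image is a neighbourhood of the point, hence the use of [near_id_jacobian]. *)
Lemma tangent_changeK i j p : source i p -> source j p ->
  tangent_change i j p *m tangent_change j i p = 1%:M.
Proof.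
move=> ip jp; rewrite /tangent_change.
have dij := transition_differentiable ip jp.
have dji : differentiable (coord i \o inv j) ((coord j \o inv i) (coord i p)).
  by rewrite /= coordK//; exact: transition_differentiable.
have -> : coord j p = (coord j \o inv i) (coord i p) by rewrite /= coordK.
rewrite -jacobian_comp//; apply: near_id_jacobian; last first.
  exact: differentiable_comp.
near=> u; have [iu ju] : target i u /\ source j (inv i u).
  by near: u; exact: near_overlap.
by rewrite /= coordK// (targetP iu).2.
Unshelve. all: by end_near. Qed.

(** By continuity the curve stays in [source i] near [t], so there its expression in [j] is the
    transition map applied to its expression in [i]. This relates [velocity], whose chart depends on
    the point, to one fixed chart. *)
Lemma curve_change i j (x : R -> M) t : {for t, continuous x} ->
  source i (x t) -> source j (x t) -> differentiable (coord i \o x) t ->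
  derive1 (coord j \o x) t = derive1 (coord i \o x) t *m tangent_change i j (x t).
Proof.
move=> cx ix jx dx; have dij := transition_differentiable ix jx.
rewrite !derive1E /tangent_change -derive_comp_jacobian//.
apply: near_eq_derive; near=> s; rewrite /= coordK//; near: s.
by apply: cx; apply: open_nbhs_nbhs; split=> //; exact: open_source.
Unshelve. all: by end_near. Qed.

End Charts.

(** * Directional derivatives of matrix-valued functions *)

Section MatrixCalculus.
Context {R : realType} {V : normedModType R}.
Implicit Types (x d : V).

Lemma is_derive_mxP {m n : nat} (A : V -> 'M[R]_(m, n)) x d dA :
  is_derive x d A dA <->
  forall i j, is_derive x d (fun y => A y i j) (dA i j).
Proof.
split=> [[dAx <-] i j|dAij]; first exact: is_derive_entry.
have dAx : derivable A x d by apply/derivable_mxP => i j; case: (dAij i j).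
apply: DeriveDef => //; apply/matrixP => i j.
by rewrite derive_mx// mxE; case: (dAij i j).
Qed.

Lemma is_derive_mulmx {m n k : nat} (A : V -> 'M[R]_(m, n)) (B : V -> 'M[R]_(n, k))
    x d dA dB :
  is_derive x d A dA -> is_derive x d B dB ->
  is_derive x d (fun y => A y *m B y) (dA *m B x + A x *m dB).
Proof.
move=> /is_derive_mxP hA /is_derive_mxP hB; apply/is_derive_mxP => i j.
rewrite !mxE -big_split/= (_ : (fun y => _) =
  fun y => \sum_l A y i l * B y l j); last by apply/funext => y; rewrite mxE.
by apply: is_derive_big => l; exact: is_derive_mul.
Qed.

Lemma is_derive_trmx {m n : nat} (A : V -> 'M[R]_(m, n)) x d dA :
  is_derive x d A dA -> is_derive x d (fun y => (A y)^T) dA^T.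
Proof.
move=> /is_derive_mxP hA; apply/is_derive_mxP => i j; rewrite mxE.
by rewrite (_ : (fun y => _) = fun y => A y j i)//; apply/funext => y; rewrite mxE.
Qed.

End MatrixCalculus.

(** * Lagrangians of degree two in the velocity *)

Section QuadraticLagrangian.
Context {R : realType} {n : nat}.
Implicit Types (G : 'M[R]_n) (w v : 'rV[R]_n) (c : R).

(** The coefficients are plain arguments, so that the velocity, the position or the time can be
    varied with one and the same derivative formula. *)
Definition quad_lagrangian G w c v : R :=
  2^-1 * (v *m G *m v^T) 0 0 - (w *m v^T) 0 0 + c.

Lemma bilinear_sym G v w : G^T = G ->
  (v *m G *m w^T) 0 0 = (w *m G *m v^T) 0 0.
Proof.
move=> GT; have <- : (v *m G *m w^T)^T 0 0 = (v *m G *m w^T) 0 0 by rewrite mxE.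
by rewrite !trmx_mul trmxK GT mulmxA.
Qed.

(** The expression is linear in [(G, w, c)], which gives the first term; varying [v] in the
    quadratic part gives two equal halves, by symmetry of [G x]. *)
Lemma is_derive_quad_lagrangian {V : normedModType R} (x d : V)
    (G : V -> 'M[R]_n) (w v : V -> 'rV[R]_n) (c : V -> R)
    (dG : 'M[R]_n) (dw dv : 'rV[R]_n) (dc : R) :
  (G x)^T = G x ->
  is_derive x d G dG -> is_derive x d w dw -> is_derive x d c dc ->
  is_derive x d v dv ->
  is_derive x d (fun y => quad_lagrangian (G y) (w y) (c y) (v y))
    (quad_lagrangian dG dw dc (v x)
     + (dv *m G x *m (v x)^T) 0 0 - (w x *m dv^T) 0 0).
Proof.
move=> GT hG hw hc hv; have hvT := is_derive_trmx hv.
have /is_derive_mxP/(_ ord0 ord0) hq :=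
  is_derive_mulmx (is_derive_mulmx hv hG) hvT.
have /is_derive_mxP/(_ ord0 ord0) hl := is_derive_mulmx hw hvT.
have := is_deriveD (is_deriveB (is_deriveZ 2^-1 hq) hl) hc.
move=> /is_derive_eq; apply.
have addE (A B : 'M[R]_1) : (A + B) ord0 ord0 = A 0 0 + B 0 0 by rewrite mxE.
rewrite mulmxDl !addE (bilinear_sym (v x) dv GT) /quad_lagrangian /GRing.scale/=.
by field.
Qed.

Lemma partial_quad_lagrangian G w c k v : G^T = G ->
  partial k (quad_lagrangian G w c) v = (v *m G - w) 0 k.
Proof.
move=> GT; have h := is_derive_quad_lagrangian (V := 'rV[R]_n)
  (G := cst G) (w := cst w) (c := cst c) (v := id) GT
  (is_derive_cst _ _ _) (is_derive_cst _ _ _) (is_derive_cst _ _ _)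
  (is_derive_id v (delta_mx 0 k)).
rewrite /partial (@derive_val _ _ _ _ _ _ _ h) /quad_lagrangian /=.
rewrite mulmx0 !mul0mx mxE mulr0 subr0 addr0 add0r.
rewrite bilinear_sym// trmx_delta.
by rewrite -!colE !mxE.
Qed.

End QuadraticLagrangian.

(** * Lowering indices with the metric *)

Section Lowering.
Context {R : realType} {n : nat} {M : manifold R n}.
Variable g : semi_riemann_metric M.
Implicit Types (i : atlas M) (p : M) (u v w : 'rV[R]_n) (a b c h k : 'I_n).

Lemma gdownT i u : (gdown g i u)^T = gdown g i u.
Proof. by rewrite /gdown /bcomp !trmx_mul trmxK gram_sym mulmxA. Qed.

Lemma gdown_symE i u a b : gdown g i u a b = gdown g i u b a.
Proof. by rewrite -[in LHS]gdownT mxE. Qed.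

Lemma gdown_unit i u : target i u -> gdown g i u \in unitmx.
Proof.
move=> iu; have [iu' _] := targetP iu.
have [TU _] := mulmx1_unit (tangent_changeK iu' (source_chart_at (inv i u))).
by rewrite /gdown /bcomp !unitmx_mul unitmx_tr TU gram_nondegenerate.
Qed.

Lemma gdown_differentiable i u a b : target i u ->
  differentiable (fun u => gdown g i u a b) u.
Proof. by move=> iu; apply: (gram_smooth g i a b 1).1. Qed.

Definition dmetric i u k a b : R := partial k (fun u => gdown g i u a b) u.

Definition dgdown i u k : 'M[R]_n := \matrix_(a, b) dmetric i u k a b.

(** Raising an index and lowering it again. It removes [gup] from the Christoffel symbols, the
    gradient and [Ftensor] alike. *)
Lemma lower_gup i u (s : 'I_n -> R) k : target i u ->
  \sum_a (\sum_h gup g i u a h * s h) * gdown g i u a k = s k.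
Proof.
move=> iu; pose S : 'cV[R]_n := \col_h s h.
have -> : s k = (gdown g i u *m (gup g i u *m S)) k 0.
  by rewrite mulKVmx ?gdown_unit// mxE.
rewrite mxE; apply: eq_bigr => a _; rewrite gdown_symE mulrC; congr (_ * _).
by rewrite mxE; apply: eq_bigr => h _; rewrite mxE.
Qed.

(** The right-hand side is the Christoffel symbol of the first kind. *)
Lemma lower_christoffel i u a b k : target i u ->
  \sum_c christoffel g i u c a b * gdown g i u c k
  = 2^-1 * (dmetric i u a b k + dmetric i u b a k - dmetric i u k a b).
Proof.
move=> iu; rewrite -[RHS](lower_gup (fun k => 2^-1 *
  (dmetric i u a b k + dmetric i u b a k - dmetric i u k a b)) _ iu).
apply: eq_bigr => c _; congr (_ * _); rewrite /christoffel mulr_sumr.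
by apply: eq_bigr => h _; rewrite mulrCA.
Qed.

(** The Euler-Lagrange expression of the kinetic energy g(v, v)/2: time derivative of the momentum v
    g minus the position derivative. *)
Definition lowered_accel i (x : R -> 'rV[R]_n) t k : R :=
  let v := derive1 x t in
  (derive1 (derive1 x) t *m gdown g i (x t)) 0 k
  + (v *m \sum_b v 0 b *: dgdown i (x t) b) 0 k
  - 2^-1 * (v *m dgdown i (x t) k *m v^T) 0 0.

Lemma lower_nabla_dt i x t k : target i (x t) ->
  (nabla_dt g i x (derive1 x) t *m gdown g i (x t)) 0 k = lowered_accel i x t k.
Proof.
move=> ix; rewrite /lowered_accel; set v := derive1 x t; set u := x t.
rewrite [LHS]mxE [X in _ = X + _ - _]mxE -addrA.
under eq_bigr => c _ do rewrite mxE mulrDl.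
rewrite big_split /=; congr (_ + _).
transitivity (\sum_a \sum_b v 0 a * v 0 b *
    (\sum_c christoffel g i u c a b * gdown g i u c k)).
  under eq_bigr => c _.
    rewrite mulr_suml; under eq_bigr => a _ do rewrite mulr_suml.
    over.
  rewrite exchange_big; apply: eq_bigr => a _ /=.
  rewrite exchange_big; apply: eq_bigr => b _ /=.
  rewrite mulr_sumr; apply: eq_bigr => c _; rewrite -/v -/u; ring.
have sE : (v *m \sum_b v 0 b *: dgdown i u b) 0 k
    = \sum_a \sum_b v 0 a * v 0 b * dmetric i u b a k.
  rewrite mxE; apply: eq_bigr => a _; rewrite summxE mulr_sumr.
  by apply: eq_bigr => b _; rewrite [X in _ * X]mxE [X in _ * (_ * X)]mxE mulrA.
have qE : (v *m dgdown i u k *m v^T) 0 0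
    = \sum_a \sum_b v 0 a * v 0 b * dmetric i u k a b.
  rewrite mxE exchange_big /=; apply: eq_bigr => b _.
  rewrite [X in _ * X]mxE [X in X * _]mxE mulr_suml.
  by apply: eq_bigr => a _; rewrite [X in _ * X * _]mxE mulrAC.
have sE' : \sum_a \sum_b v 0 a * v 0 b * dmetric i u a b k
    = \sum_a \sum_b v 0 a * v 0 b * dmetric i u b a k.
  rewrite exchange_big; apply: eq_bigr => a _; apply: eq_bigr => b _ /=.
  by rewrite [v 0 b * _]mulrC.
rewrite sE qE.
(* Contracted with the symmetric v^a v^b, the first two terms of the Christoffel symbol agree; the
   single sum is split into two halves to match them. *)
have -> : \sum_a \sum_b v 0 a * v 0 b * dmetric i u b a k
  = 2^-1 * \sum_a \sum_b v 0 a * v 0 b * dmetric i u a b k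
   + 2^-1 * \sum_a \sum_b v 0 a * v 0 b * dmetric i u b a k.
  by rewrite sE'; field.
rewrite -mulrDr -mulrBr -big_split -sumrB mulr_sumr; apply: eq_bigr => a _ /=.
rewrite -big_split -sumrB mulr_sumr; apply: eq_bigr => b _ /=.
by rewrite lower_christoffel//; ring.
Qed.

Lemma lower_grad i (f : M -> R) u k : target i u ->
  (grad g i f u *m gdown g i u) 0 k = partial k (f \o inv i) u.
Proof.
move=> iu; rewrite -[RHS](lower_gup (fun k => partial k (f \o inv i) u) _ iu).
by rewrite mxE; apply: eq_bigr => a _; rewrite mxE.
Qed.

(* [w p] gives the components of a covector at p in the dual frame of the chart
   [chart_at p]. *)
Definition covector_comp i (w : M -> 'rV[R]_n) u : 'rV[R]_n :=
  w (inv i u) *m (tangent_change i (chart_at (inv i u)) (inv i u))^T.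

Definition flat (X : M -> 'rV[R]_n) p : 'rV[R]_n := X p *m g p.

Lemma covector_comp_flat i (X : M -> 'rV[R]_n) u : target i u ->
  covector_comp i (flat X) u = vcomp i X u *m gdown g i u.
Proof.
move=> iu; have [iu' _] := targetP iu.
have := tangent_changeK (source_chart_at (inv i u)) iu'.
rewrite /covector_comp /flat /vcomp /gdown /bcomp.
move: (tangent_change i _ _) (tangent_change _ i _) => T S ST.
by rewrite -!mulmxA (mulmxA S) ST mul1mx.
Qed.

Definition exterior_derivative i (w : M -> 'rV[R]_n) u b k : R :=
  partial b (fun u => covector_comp i w u 0 k) u
  - partial k (fun u => covector_comp i w u 0 b) u.

(** The product rule, with the derivative of the metric written through the Christoffel symbols
    because the metric is parallel. One of the two resulting terms completes the partial derivative
    of X to [nabla]; the other is symmetric in [b] and [k], so it will drop out of the exterior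
    derivative. *)
Lemma is_derive_flat i (X : vector_field M) u b k : target i u ->
  is_derive u (delta_mx 0 b) (fun u => covector_comp i (flat X) u 0 k)
   (\sum_a nabla g i X u b a * gdown g i u a k
    + \sum_a \sum_c vcomp i X u 0 a * gdown g i u a c * christoffel g i u c b k).
Proof.
move=> iu.
have dX a : is_derive u (delta_mx 0 b) (fun u => vcomp i X u 0 a)
    (partial b (fun u => vcomp i X u 0 a) u).
  apply: derivableP; apply: (derivable_mxP _ _ _).1.
  by apply: diff_derivable; apply: (vf_smooth X i 1).1.
have dG a : is_derive u (delta_mx 0 b) (fun u => gdown g i u a k) (dmetric i u b a k).
  by apply: derivableP; apply: diff_derivable; exact: gdown_differentiable.
apply: (near_eq_is_derive (f := fun u => \sum_a vcomp i X u 0 a * gdown g i u a k)).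
  near=> u'; rewrite covector_comp_flat ?[in RHS]mxE//.
  by near: u'; exact: near_target.
have := is_derive_big (fun a => is_derive_mul (dX a) (dG a)).
move=> /is_derive_eq; apply.
(* [levi_civitaP] is applied to the Christoffel symbols themselves, to extract that the metric is
   parallel. *)
have [_ par] := (levi_civitaP (fun c a b => christoffel g i u c a b)
  (gdown_unit iu)).2 (fun _ _ _ => erefl).
have dGE a : dmetric i u b a k = \sum_c (christoffel g i u c b a * gdown g i u c k
    + christoffel g i u c b k * gdown g i u a c) by exact: par.
have nablaE a : nabla g i X u b a = partial b (fun u => vcomp i X u 0 a) u
    + \sum_c christoffel g i u a b c * vcomp i X u 0 c by rewrite mxE.
under [in RHS]eq_bigr => a _ do rewrite nablaE mulrDl.
rewrite !big_split /= -addrA; congr (_ + _).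
under eq_bigr => a _ do rewrite dGE big_split mulrDr.
rewrite big_split /=; congr (_ + _).
  under [in RHS]eq_bigr => a _ do rewrite mulr_suml.
  rewrite exchange_big /=; apply: eq_bigr => a _; rewrite mulr_sumr.
  by apply: eq_bigr => c _; ring.
apply: eq_bigr => a _; rewrite mulr_sumr; apply: eq_bigr => c _; ring.
Unshelve. all: by end_near. Qed.

(** Lowering the upper index of F gives nabla_b X_k - nabla_k X_b, and torsion-freeness turns
    covariant derivatives into partial ones in this antisymmetric combination. *)
Lemma lower_Ftensor i (X : vector_field M) u v k : target i u ->
  (v *m Ftensor g i X u *m gdown g i u) 0 k
  = \sum_b v 0 b * exterior_derivative i (flat X) u b k.
Proof.
move=> iu; rewrite -mulmxA mxE; apply: eq_bigr => b _; congr (_ * _).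
have [sym _] := (levi_civitaP (fun c a b => christoffel g i u c a b)
  (gdown_unit iu)).2 (fun _ _ _ => erefl).
have FE a : Ftensor g i X u b a = nabla g i X u b a
    - \sum_h gup g i u a h * \sum_c gdown g i u c b * nabla g i X u h c.
  rewrite mxE; congr (_ - _); apply: eq_bigr => h _; rewrite mulr_sumr.
  by apply: eq_bigr => c _; rewrite mulrA.
rewrite mxE; under eq_bigr => a _ do rewrite FE mulrBl.
rewrite sumrB (lower_gup (fun h => \sum_c gdown g i u c b * nabla g i X u h c))//.
rewrite /exterior_derivative /partial.
rewrite (@derive_val _ _ _ _ _ _ _ (is_derive_flat X b k iu)).
rewrite (@derive_val _ _ _ _ _ _ _ (is_derive_flat X k b iu)).
rewrite opprD addrACA -[LHS]addr0; congr (_ + _).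
  by congr (_ - _); apply: eq_bigr => c _; rewrite mulrC.
apply/esym/eqP; rewrite subr_eq0; apply/eqP.
by apply: eq_bigr => a _; apply: eq_bigr => c _; rewrite sym.
Qed.

End Lowering.

(** * Curves of class C^2 read in a chart *)

Section Curves.
Context {R : realType} {n : nat} {M : manifold R n}.
Implicit Types (i : atlas M) (J : set R) (x : R -> M).

Lemma C2_curve_coord J x i t : C2_curve J x -> J t -> source i (x t) ->
  differentiable (coord i \o x) t /\ differentiable (derive1 (coord i \o x)) t.
Proof.
move=> [_ /(_ i) [dx ddx]] Jt ix; split; first exact: dx.
rewrite (_ : derive1 _ = fun s => 'D_1 (coord i \o x) s); first exact: (ddx 1).1.
by apply/funext => s; rewrite derive1E.
Qed.

Lemma near_curve J x i t : open J -> C2_curve J x -> J t -> source i (x t) ->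
  \forall s \near t, J s /\ source i (x s).
Proof.
move=> oJ [cx _] Jt ix; near=> s; split; near: s.
  by apply: open_nbhs_nbhs.
by apply: cx => //; apply: open_nbhs_nbhs; split => //; exact: open_source.
Unshelve. all: by end_near. Qed.

End Curves.

(** * Euler-Lagrange equations and energy for a general covector field [w] *)

Section MagneticSystem.
Context {R : realType} {n : nat} {M : manifold R n}.
Variable g : semi_riemann_metric M.
Variables (w : M -> 'rV[R]_n) (f : M -> R).
Variable force : atlas M -> 'rV[R]_n -> 'rV[R]_n -> 'rV[R]_n.
Implicit Types (i : atlas M) (p : M) (u v : 'rV[R]_n) (a b c h k : 'I_n).
Implicit Types (J : set R) (x : R -> M).

(** The Lagrangian of a charged particle with vector potential [w], up to sign, and potential energy
    -f. *)
Definition magnetic_lagrangian p v : R := quad_lagrangian (g p) (w p) (f p) v.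

(** By Euler's homogeneity relation the velocity derivative counts the quadratic part twice and the
    linear part once, so subtracting L cancels [w]. This is why (A) and (B) share their
    Hamiltonian. *)
Lemma hamiltonian_magnetic p v :
  hamiltonian magnetic_lagrangian p v = 2^-1 * inner g p v v - f p.
Proof.
rewrite /hamiltonian /magnetic_lagrangian.
under eq_bigr => k _ do rewrite partial_quad_lagrangian ?gram_sym//.
have -> : \sum_k v 0 k * (v *m g p - w p) 0 k = ((v *m g p - w p) *m v^T) 0 0.
  by rewrite mxE; apply: eq_bigr => k _; rewrite [v^T _ _]mxE mulrC.
by rewrite mulmxBl [X in X - _]mxE [X in _ + X - _]mxE /quad_lagrangian /inner; field.
Qed.

Lemma lcomp_magnetic i u : lcomp i magnetic_lagrangian u =
  quad_lagrangian (gdown g i u) (covector_comp i w u) (f (inv i u)).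
Proof.
apply/funext => v; rewrite /lcomp /magnetic_lagrangian /quad_lagrangian.
rewrite /gdown /bcomp /covector_comp.
by move: (tangent_change _ _ _) => T; rewrite trmx_mul !mulmxA.
Qed.

Hypothesis w_differentiable : forall i u k, target i u ->
  differentiable (fun u => covector_comp i w u 0 k) u.
Hypothesis f_differentiable : forall i u, target i u ->
  differentiable (f \o inv i) u.
(** All that is known of the force: its lowering is df + dw(v, -). [lower_systemA] and
    [lower_systemB] supply this for the two systems. *)
Hypothesis lower_force : forall i u v k, target i u ->
  (force i u v *m gdown g i u) 0 k
  = partial k (f \o inv i) u + \sum_b v 0 b * exterior_derivative i w u b k.

(** * The equations in one chart at one time *)

Section Chart.
Variables (i : atlas M) (x : R -> 'rV[R]_n) (t : R).
Hypothesis ix : target i (x t).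
Hypothesis dx : differentiable x t.
Hypothesis ddx : differentiable (derive1 x) t.
Let v : 'rV[R]_n := derive1 x t.

Lemma is_derive_velocity : is_derive t 1 (derive1 x) (derive1 (derive1 x) t).
Proof. by rewrite [X in is_derive _ _ _ X]derive1E; apply/derivableP/diff_derivable. Qed.

Lemma is_derive_gdown :
  is_derive t 1 (fun s => gdown g i (x s)) (\sum_b v 0 b *: dgdown g i (x t) b).
Proof.
apply/is_derive_mxP => a c; rewrite summxE.
have E b : (v 0 b *: dgdown g i (x t) b) a c =
    v 0 b * partial b (fun u => gdown g i u a c) (x t).
  by rewrite mxE [X in _ * X]mxE.
under eq_bigr => b _ do rewrite E.
exact: (is_derive_along (gdown_differentiable g a c ix) dx).
Qed.

Definition covector_along : 'rV[R]_n :=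
  \row_k \sum_b v 0 b * partial b (fun u => covector_comp i w u 0 k) (x t).

Lemma is_derive_covector :
  is_derive t 1 (fun s => covector_comp i w (x s)) covector_along.
Proof.
apply/is_derive_mxP => a c; rewrite [a]ord1 [X in is_derive _ _ _ X]mxE.
exact: (is_derive_along (w_differentiable c ix) dx).
Qed.

Definition momentum_derivative : 'rV[R]_n :=
  derive1 (derive1 x) t *m gdown g i (x t)
  + v *m (\sum_b v 0 b *: dgdown g i (x t) b) - covector_along.

Lemma is_derive_momentum k :
  is_derive t 1 (fun s => partial k (lcomp i magnetic_lagrangian (x s)) (derive1 x s))
    (momentum_derivative 0 k).
Proof.
rewrite (_ : (fun s => _) =
    fun s => (derive1 x s *m gdown g i (x s) - covector_comp i w (x s)) 0 k).
  apply: (is_derive_mxP _ _ _ _).1.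
  exact: is_deriveB (is_derive_mulmx is_derive_velocity is_derive_gdown)
    is_derive_covector.
by apply/funext => s; rewrite lcomp_magnetic partial_quad_lagrangian// gdownT.
Qed.

(** The position varies while the velocity components stay frozen, so only the derivatives of the
    coefficients contribute. *)
Lemma partial_lcomp_magnetic k :
  partial k (fun u => lcomp i magnetic_lagrangian u v) (x t)
  = 2^-1 * (v *m dgdown g i (x t) k *m v^T) 0 0
    - \sum_b v 0 b * partial k (fun u => covector_comp i w u 0 b) (x t)
    + partial k (f \o inv i) (x t).
Proof.
pose dw : 'rV[R]_n := \row_b partial k (fun u => covector_comp i w u 0 b) (x t).
have hG : is_derive (x t) (delta_mx 0 k) (gdown g i) (dgdown g i (x t) k).
  apply/is_derive_mxP => a b; rewrite [X in is_derive _ _ _ X]mxE.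
  by apply/derivableP/diff_derivable; exact: gdown_differentiable.
have hw : is_derive (x t) (delta_mx 0 k) (covector_comp i w) dw.
  apply/is_derive_mxP => a b; rewrite [a]ord1 [X in is_derive _ _ _ X]mxE.
  by apply/derivableP/diff_derivable; exact: w_differentiable.
have hf : is_derive (x t) (delta_mx 0 k) (f \o inv i) (partial k (f \o inv i) (x t)).
  by apply/derivableP/diff_derivable; exact: f_differentiable.
have := is_derive_quad_lagrangian (gdownT g i (x t)) hG hw hf
  (is_derive_cst v (x t) (delta_mx 0 k)).
rewrite (_ : (fun y => _) = fun u => lcomp i magnetic_lagrangian u v); last first.
  by apply/funext => u; rewrite lcomp_magnetic.
move=> h; rewrite {1}/partial (@derive_val _ _ _ _ _ _ _ h).
rewrite trmx0 mulmx0 !mul0mx [X in _ + X - _]mxE [X in _ - X]mxE subr0 addr0.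
rewrite /quad_lagrangian; congr (_ - _ + _).
by rewrite mxE; apply: eq_bigr => b _; rewrite [X in X * _]mxE [X in _ * X]mxE mulrC.
Qed.

(** Nondegeneracy of the metric allows the vector equation to be tested after lowering the index. *)
Lemma euler_lagrange_magnetic :
  nabla_dt g i x (derive1 x) t = force i (x t) v <->
  forall k, momentum_derivative 0 k
    = partial k (fun u => lcomp i magnetic_lagrangian u v) (x t).
Proof.
have lowE (y z : 'rV[R]_n) : y = z <->
    forall k, (y *m gdown g i (x t)) 0 k = (z *m gdown g i (x t)) 0 k.
  split=> [->//|yz]; rewrite -[y](mulmxK (gdown_unit g ix)).
  by rewrite -[RHS](mulmxK (gdown_unit g ix)); congr (_ *m _); exact/rowP.
have pE k : momentum_derivative 0 k =
    (derive1 (derive1 x) t *m gdown g i (x t)) 0 k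
    + (v *m (\sum_b v 0 b *: dgdown g i (x t) b)) 0 k
    - \sum_b v 0 b * partial b (fun u => covector_comp i w u 0 k) (x t).
  rewrite mxE; congr (_ + _); first by rewrite mxE.
  by rewrite mxE; congr (- _); rewrite mxE.
have fE k : (force i (x t) v *m gdown g i (x t)) 0 k = partial k (f \o inv i) (x t)
    + \sum_b v 0 b * partial b (fun u => covector_comp i w u 0 k) (x t)
    - \sum_b v 0 b * partial k (fun u => covector_comp i w u 0 b) (x t).
  rewrite lower_force// -addrA -sumrB; congr (_ + _).
  by apply: eq_bigr => b _; rewrite mulrBr.
(* With everything moved to one side, both equations are the vanishing of the same expression, so
   one computation serves both directions. *)
rewrite lowE; split=> H k; have /eqP := H k; rewrite partial_lcomp_magnetic
  lower_nabla_dt// fE pE /lowered_accel -/v -subr_eq0 => E0;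
  apply/eqP; rewrite -subr_eq0; apply: etrans E0; congr (_ == _); ring.
Qed.

Definition energy s : R :=
  2^-1 * (derive1 x s *m gdown g i (x s) *m (derive1 x s)^T) 0 0 - f (inv i (x s)).

(** Pairing the lowered equation with the velocity gives the derivative of g(v, v)/2 on the left and
    that of f along the curve on the right. *)
Lemma is_derive_energy : nabla_dt g i x (derive1 x) t = force i (x t) v ->
  is_derive t 1 energy 0.
Proof.
move=> eqn; have hv := is_derive_velocity.
have zE : (0 : 'M[R]_1) 0 0 = 0 by rewrite mxE.
have hf := is_derive_along (f_differentiable ix) dx.
(* The energy is itself a [quad_lagrangian], with zero linear part and constant term -f. *)
have := is_derive_quad_lagrangian (G := fun s => gdown g i (x s))
  (gdownT g i (x t)) is_derive_gdown
  (is_derive_cst (0 : 'rV[R]_n) t 1) (is_deriveN hf) hv.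
rewrite (_ : (fun y => _) = energy); last first.
  by apply/funext => s; rewrite /quad_lagrangian mul0mx zE subr0.
move=> /is_derive_eq; apply.
rewrite /quad_lagrangian !mul0mx !zE !subr0 -/v.
set a := derive1 (derive1 x) t.
have : \sum_k v 0 k * (nabla_dt g i x (derive1 x) t *m gdown g i (x t)) 0 k
    = \sum_k v 0 k * (force i (x t) v *m gdown g i (x t)) 0 k
  by rewrite eqn.
under [in RHS]eq_bigr => k _ do rewrite lower_force// mulrDr.
rewrite big_split /=.
(* dw(v, v) = 0: the two double sums are exchanged by swapping [b] and [k]. *)
have -> : \sum_k v 0 k * \sum_b v 0 b * exterior_derivative i w (x t) b k = 0.
  under eq_bigr => k _.
    rewrite mulr_sumr; under eq_bigr => b _ do rewrite mulrBr mulrBr.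
    rewrite sumrB; over.
  rewrite sumrB [X in _ - X]exchange_big /=; apply/eqP; rewrite subr_eq0; apply/eqP.
  by apply: eq_bigr => k _; apply: eq_bigr => b _; rewrite mulrCA.
rewrite addr0 => <-.
under [X in _ - X + _]eq_bigr => k _
  do rewrite lower_nabla_dt// /lowered_accel -/v -/a mulrBr mulrDr.
have vE (y : 'rV[R]_n) : \sum_k v 0 k * y 0 k = (y *m v^T) 0 0.
  by rewrite mxE; apply: eq_bigr => k _; rewrite [v^T _ _]mxE mulrC.
rewrite sumrB big_split /= !vE.
have -> : \sum_k v 0 k * (2^-1 * (v *m dgdown g i (x t) k *m v^T) 0 0)
    = 2^-1 * (v *m (\sum_k v 0 k *: dgdown g i (x t) k) *m v^T) 0 0.
  rewrite mulmx_sumr mulmx_suml summxE mulr_sumr; apply: eq_bigr => k _.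
  by rewrite -scalemxAr -scalemxAl [in RHS]mxE mulrCA.
by field.
Qed.

End Chart.

Lemma inner_chart i p v : source i p ->
  let v' := v *m tangent_change i (chart_at p) p in
  inner g p v' v' = (v *m gdown g i (coord i p) *m v^T) 0 0.
Proof.
move=> ip; rewrite /inner /gdown /bcomp (coordK ip) /=.
by move: (tangent_change _ _ _) => T; rewrite trmx_mul !mulmxA.
Qed.

Lemma trajectory_extremal J x :
  trajectory g force J x <-> extremal magnetic_lagrangian J x.
Proof.
split=> -[oJ iJ c2x eqn]; split=> // i t Jt ix /=.
  have [dx ddx] := C2_curve_coord c2x Jt ix.
  have tx : target i ((coord i \o x) t) by exists (x t).
  move=> k; have := is_derive_momentum tx dx ddx k.
  by move=> /is_derive_eq; apply; apply: (euler_lagrange_magnetic tx).1; exact: eqn.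
have [dx ddx] := C2_curve_coord c2x Jt ix.
have tx : target i ((coord i \o x) t) by exists (x t).
apply/(euler_lagrange_magnetic tx) => k.
rewrite -(@derive_val _ _ _ _ _ _ _ (is_derive_momentum tx dx ddx k)).
exact: (@derive_val _ _ _ _ _ _ _ (eqn i t Jt ix k)).
Qed.

Lemma conservative_magnetic :
  conservative (trajectory g force) (hamiltonian magnetic_lagrangian).
Proof.
move=> J x [oJ iJ c2x eqn].
pose h t := hamiltonian magnetic_lagrangian (x t) (velocity x t).
have dh t : J t -> is_derive t 1 h 0.
  move=> Jt; pose i := chart_at (x t); have ix : source i (x t) := source_chart_at _.
  have [dx ddx] := C2_curve_coord c2x Jt ix.
  have tx : target i ((coord i \o x) t) by exists (x t).
  (* [velocity] uses the chart chosen at [x s], which may jump with [s]. Near [t] the value of [h]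
     is therefore rewritten as the energy in the fixed chart [i]. *)
  apply: near_eq_is_derive (is_derive_energy tx dx ddx (eqn i t Jt ix)).
  near=> s; have [Js jx] : J s /\ source i (x s) by near: s; exact: near_curve c2x Jt ix.
  have [dxs _] := C2_curve_coord c2x Js jx.
  rewrite /h hamiltonian_magnetic /velocity.
  rewrite (curve_change (c2x.1 s Js) jx (source_chart_at _) dxs) inner_chart//.
  by rewrite /energy -[(coord i \o x) s]/(coord i (x s)) (coordK jx).
suff cst_h t1 t2 : t1 <= t2 -> J t1 -> J t2 -> h t1 = h t2.
  move=> t1 t2 J1 J2; case: (leP t1 t2) => [|/ltW] t12; first exact: cst_h.
  by apply/esym; exact: cst_h.
move=> t12 J1 J2.
have Jt t : t \in `[t1, t2] -> J t.
  by rewrite in_itv/= => /andP[t1t tt2]; apply: (iJ t1 t2); rewrite ?t1t.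
(* As [J] is an interval, it contains the whole segment, on which [h] has zero derivative. *)
have [| |c _] := @MVT_segment _ h (cst 0) _ _ t12.
- by move=> t /subset_itv_oo_cc/Jt; exact: dh.
- by apply: derivable_within_continuous => t /Jt/dh[].
- by rewrite mul0r => /eqP; rewrite subr_eq0 => /eqP.
Unshelve. all: by end_near. Qed.

End MagneticSystem.

(** * The systems (A) and (B) as instances *)

Section Systems.
Context {R : realType} {n : nat} {M : manifold R n}.
Variable g : semi_riemann_metric M.

Lemma covector_comp0 (i : atlas M) u : covector_comp i (fun=> 0) u = 0.
Proof. exact: mul0mx. Qed.

Lemma exterior_derivative0 (i : atlas M) u b k :
  exterior_derivative i (fun=> 0) u b k = 0.
Proof.
rewrite /exterior_derivative /partial.
have E c : (fun u => covector_comp i (fun=> 0) u 0 c) = cst (0 : R).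
  by apply/funext => u'; rewrite covector_comp0 mxE.
by rewrite !E !derive_cst subrr.
Qed.

Lemma covector_comp0_differentiable (i : atlas M) u k : target i u ->
  differentiable (fun u => covector_comp i (fun=> 0) u 0 k) u.
Proof.
move=> _; rewrite (_ : (fun u => _) = cst 0); first exact: differentiable_cst.
by apply/funext => u'; rewrite covector_comp0 mxE.
Qed.

Variable X : vector_field M.
Let f (p : M) : R := 2^-1 * inner g p (X p) (X p).

(** On the open target these components are sums of products of chart components of X and of the
    metric, which are smooth. *)
Lemma flat_differentiable i u k : target i u ->
  differentiable (fun u => covector_comp i (flat g X) u 0 k) u.
Proof.
move=> iu; apply: (near_eq_differentiable
    (f := fun u => \sum_a vcomp i X u 0 a * gdown g i u a k)).
  near=> u'; rewrite covector_comp_flat ?[in RHS]mxE//.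
  by near: u'; exact: near_target.
rewrite (_ : (fun u => _) = \sum_a (fun u => vcomp i X u 0 a * gdown g i u a k)).
  apply: differentiable_sum => a; apply: differentiableM.
    apply: (differentiable_comp (f := vcomp i X) (g := fun v : 'rV[R]_n => v 0 a)).
      exact: (vf_smooth X i 1).1.
    exact: differentiable_coord.
  exact: gdown_differentiable.
by apply/funext => u'; rewrite fct_sumE.
Unshelve. all: by end_near. Qed.

(** The values [X p] and [g p] refer to the chart chosen at [p] and need not vary continuously, so
    g(X, X) is rewritten near [u] as the pairing of g(X, -) with X in the fixed chart, where the
    tangent changes cancel. *)
Lemma half_sqnorm_differentiable i u : target i u -> differentiable (f \o inv i) u.
Proof.
move=> iu; apply: (near_eq_differentiable
    (f := fun u => 2^-1 * \sum_k covector_comp i (flat g X) u 0 k * vcomp i X u 0 k)).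
  near=> u'; have iu' : target i u' by near: u'; exact: near_target.
  rewrite /f /= /inner; congr (_ * _).
  have [ip _] := targetP iu'.
  have ST := tangent_changeK (source_chart_at (inv i u')) ip.
  transitivity ((covector_comp i (flat g X) u' *m (vcomp i X u')^T) 0 0).
    by rewrite mxE; apply: eq_bigr => k _; rewrite [X in _ = _ * X]mxE.
  rewrite /covector_comp /flat /vcomp.
  move: (tangent_change i _ _) (tangent_change _ i _) ST => T S ST.
  by rewrite trmx_mul mulmxA -(mulmxA _ T^T) -trmx_mul ST trmx1 mulmx1.
apply: differentiableM; first exact: differentiable_cst.
rewrite (_ : (fun u => _) =
    \sum_k (fun u => covector_comp i (flat g X) u 0 k * vcomp i X u 0 k)).
  apply: differentiable_sum => a; apply: differentiableM.
    exact: flat_differentiable.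
  apply: (differentiable_comp (f := vcomp i X) (g := fun v : 'rV[R]_n => v 0 a)).
    exact: (vf_smooth X i 1).1.
  exact: differentiable_coord.
by apply/funext => u'; rewrite fct_sumE.
Unshelve. all: by end_near. Qed.

Lemma lower_systemA i u v k : target i u ->
  (systemA g f i u v *m gdown g i u) 0 k
  = partial k (f \o inv i) u
    + \sum_b v 0 b * exterior_derivative i (fun=> 0) u b k.
Proof.
move=> iu; rewrite lower_grad// [X in _ + X]big1 ?addr0// => b _.
by rewrite exterior_derivative0 mulr0.
Qed.

Lemma lower_systemB i u v k : target i u ->
  (systemB g X f i u v *m gdown g i u) 0 k
  = partial k (f \o inv i) u
    + \sum_b v 0 b * exterior_derivative i (flat g X) u b k.
Proof.
by move=> iu; rewrite mulmxDl [LHS]mxE lower_grad// lower_Ftensor.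
Qed.

End Systems.

Theorem mainTheorem2 (R : realType) (n : nat) (M : manifold R n)
    (g : semi_riemann_metric M) (X : vector_field M) :
  let f := fun p : M => 2^-1 * inner g p (X p) (X p) in
  let LA := fun (p : M) (v : 'rV[R]_n) => 2^-1 * inner g p v v + f p in
  let LB := fun (p : M) (v : 'rV[R]_n) =>
    2^-1 * inner g p (v - X p) (v - X p) in
  let H := fun (p : M) (v : 'rV[R]_n) => 2^-1 * inner g p v v - f p in
  let trajA := trajectory g (systemA g f) in
  let trajB := trajectory g (systemB g X f) in
  (forall (J : set R) (x : R -> M), trajA J x <-> extremal LA J x) /\
  ((forall p v, LB p v = 2^-1 * inner g p v v - inner g p (X p) v + f p) /\
   (forall (J : set R) (x : R -> M), trajB J x <-> extremal LB J x)) /\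
  (conservative trajA (hamiltonian LA) /\
   conservative trajB (hamiltonian LB) /\
   (forall p v, hamiltonian LA p v = H p v) /\
   (forall p v, hamiltonian LB p v = H p v)).
Proof.
move=> f LA LB H trajA trajB.
have LAE : LA = magnetic_lagrangian g (fun=> 0) f.
  apply/funext => p; apply/funext => v.
  rewrite /LA /magnetic_lagrangian /quad_lagrangian mul0mx.
  by rewrite [X in _ = _ - X + _]mxE subr0.
have LBE p v : LB p v = 2^-1 * inner g p v v - inner g p (X p) v + f p.
  rewrite /LB /f /inner; set G := g p; set Y := X p.
  have GT : G^T = G by exact: gram_sym.
  have BE (y z t : 'rV[R]_n) : ((y - z) *m G *m t^T) 0 0
      = (y *m G *m t^T) 0 0 - (z *m G *m t^T) 0 0.
    by rewrite !mulmxBl mxE [X in _ + X]mxE.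
  (* [BE] expands only the left argument, so symmetry first moves the difference there; the
     remaining g(X, X)/2 is f. *)
  rewrite BE !(bilinear_sym _ (v - Y) GT) !BE (bilinear_sym v Y GT).
  by field.
have LBm : LB = magnetic_lagrangian g (flat g X) f.
  by apply/funext => p; apply/funext => v; rewrite LBE.
have w0 := @covector_comp0_differentiable _ _ M.
have df := @half_sqnorm_differentiable _ _ _ g X.
have wB := @flat_differentiable _ _ _ g X.
have fA := @lower_systemA _ _ _ g X.
have fB := @lower_systemB _ _ _ g X.
split; first by move=> J x; rewrite LAE; exact: (trajectory_extremal w0 df fA).
split.
  by split=> // J x; rewrite LBm; exact: (trajectory_extremal wB df fB).
split; first by rewrite LAE; exact: (conservative_magnetic df fA).
split; first by rewrite LBm; exact: (conservative_magnetic df fB).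
by split=> p v; rewrite ?LAE ?LBm hamiltonian_magnetic.
Qed.
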